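(* Let $P$ be a fixed 0-1 matrix such that $\mathrm{ex}(n,P)=O(n)$. Suppose that one of the following operations is performed to yield a family of 0-1 matrices $\{P_j\}_{j\ge1}$. Then the Ramsey numbers of the ordered graphs $\mathcal G_{P_j}$ grow linearly with respect to their size, i.e. $R(\mathcal G_{P_j})=\Theta(v(\mathcal G_{P_j}))$, where the implied constants are independent of $j$ and $v(\mathcal G_{P_j})$ is the number of vertices. 1. Assume $P$ has a one in its first or last row or column. Let $P_j$ be obtained from $P$ by performing $j$ times in succession the following operation: add a new first column (or a new last column, or a new first row, or a new last row) containing exactly one 1, placed next to a 1 of the current matrix that lies in its first column (respectively last column, first row, last row). Thus the sum of the numbers of rows and columns of $P_j$ is $j$ more than that of $P$. 2. Assume $P$ has two adjacent ones in some row. Let $P_j$ be obtained from $P$ by inserting $j$ new columns between the two columns containing these ones, each new column having exactly one 1, which lies in the row of the two adjacent ones. 3. Assume $P$ has two adjacent ones in the top row, in columns $c$ and $c+1$. Let $P'$ be obtained from $P$ by inserting two empty (all-zero) columns between columns $c$ and $c+1$ and then adding a new first row with exactly two ones, both in the two new columns. Let $P_j$ be obtained from $P'$ by inserting $j$ new columns between the two columns containing the ones of the first row of $P'$, each new column having exactly one 1, which lies in the first row. 4. Assume $P$ has ones in the bottom right corner and the top left corner. Let $P_0=P$ and, for $j\ge1$, let $P_j$ be obtained from $P_{j-1}$ and a copy of $P$ by placing them so that the bottom right corner of $P_{j-1}$ is in the same location as the top left corner of the copy of $P$, with all entries outside these two matrices equal to zero. 5. (No additional requirement on $P$.) Let $P_j$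 be obtained from $P$ by inserting $j$ empty rows between every adjacent pair of rows of $P$ and $j$ empty columns between every adjacent pair of columns of $P$.
   Context: A 0-1 matrix $A$ contains a 0-1 matrix $P$ if some submatrix of $A$ (obtained by deleting rows and columns) equals $P$ or can be turned into $P$ by changing some ones to zeroes; otherwise $A$ avoids $P$. $\mathrm{ex}(n,P)$ is the maximum number of ones in an $n\times n$ 0-1 matrix that avoids $P$. An ordered graph is a finite simple graph with a linear ordering of its vertices. A copy of $\mathcal H$ in $\mathcal G$ is an order-preserving injection from the vertices of $\mathcal H$ to those of $\mathcal G$ that maps edges to edges. $R(\mathcal G)$ is the minimum $N$ such that every 2-coloring of the edges of the complete ordered graph on $N$ vertices contains a monochromatic copy of $\mathcal G$. For an $a\times b$ 0-1 matrix $P$, $\mathcal G_P$ is the ordered graph on $a+b$ vertices $u_1<\dots<u_a<w_1<\dots<w_b$ with edge set $\{u_iw_j:P(i,j)=1\}$. Rows are indexed from top to bottom and columns from left to right. *)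

(* Defs.v *)
From mathcomp Require Import all_boot matrix.
Set Implicit Arguments.
Unset Strict Implicit.
Unset Printing Implicit Defensive.

Record mat01 := Mat01 {
  nrows : nat;
  ncols : nat;
  mx01 :> 'M[bool]_(nrows, ncols)
}.

(* Rows and columns are numbered from 0; positions outside the matrix read as
   false, so [entry P i k] also asserts that (i, k) is a position of P. *)
Definition entry (P : mat01) (i k : nat) : bool :=
  match insub i, insub k with
  | Some i', Some k' => P i' k'
  | _, _ => false
  end.

Definition build01 (a b : nat) (F : nat -> nat -> bool) : mat01 :=
  Mat01 (\matrix_(i < a, k < b) F i k).

Definition increasing (m n : nat) (f : {ffun 'I_m -> 'I_n}) : bool :=
  [forall x : 'I_m, forall y : 'I_m, (x < y) ==> (f x < f y)].

Definition contains (A P : mat01) : bool :=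
  [exists f : {ffun 'I_(nrows P) -> 'I_(nrows A)},
   exists g : {ffun 'I_(ncols P) -> 'I_(ncols A)},
    [&& increasing f, increasing g &
        [forall i, forall k, P i k ==> mxsub f g A i k]]].

Definition ones (n : nat) (A : 'M[bool]_n) : nat :=
  #|[set ik : 'I_n * 'I_n | A ik.1 ik.2]|.

(* The empty maximum is 0: this is the value when every n x n matrix contains P,
   which happens only if P has no ones. *)
Definition ex_max (n : nat) (P : mat01) : nat :=
  \max_(A : 'M[bool]_n | ~~ contains (Mat01 A) P) ones A.

Definition ex_linear (P : mat01) : Prop :=
  exists C n0 : nat, forall n : nat, n0 <= n -> ex_max n P <= C * n.

(* A finite linearly ordered vertex set is canonically some 'I_n with the
   order of its elements as natural numbers. *)
Record ordgraph := OrdGraph {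
  nverts : nat;
  edge : rel 'I_nverts;
  edge_sym : symmetric edge;
  edge_irrefl : irreflexive edge
}.

Definition is_copy (H G : ordgraph) (f : {ffun 'I_(nverts H) -> 'I_(nverts G)})
    : bool :=
  increasing f && [forall u, forall v, edge u v ==> edge (f u) (f v)].

Definition complete_edge (n : nat) : rel 'I_n := fun u v => u != v.

Lemma complete_edge_sym n : symmetric (@complete_edge n).
Proof. by move=> u v; rewrite /complete_edge eq_sym. Qed.

Lemma complete_edge_irrefl n : irreflexive (@complete_edge n).
Proof. by move=> u; rewrite /complete_edge eqxx. Qed.

Definition complete (n : nat) : ordgraph :=
  OrdGraph (@complete_edge_sym n) (@complete_edge_irrefl n).

(* The edge uv is the set {u, v}; only the values of [chi] on two-element sets
   are ever used. *)
Definition arrows (N : nat) (G : ordgraph) : bool :=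
  [forall chi : {ffun {set 'I_N} -> bool},
    [exists f : {ffun 'I_(nverts G) -> 'I_(nverts (complete N))},
      is_copy f &&
      [exists color : bool, [forall u, forall v,
         edge u v ==> (chi [set f u; f v] == color)]]]].

(* Finite Ramsey theorem, needed for [ramsey] to be a total function. *)
Lemma ramsey_seq (T : eqType) (s t : nat) :
  exists N, forall (c : rel T) (X : seq T), N <= size X ->
    exists2 Y, subseq Y X &
      (size Y == s) && pairwise c Y \/
      (size Y == t) && pairwise (fun x y => ~~ c x y) Y.
Proof.
have [n] := ubnP (s + t); elim: n s t => // n IH [|s] [|t] le_n;
  try by exists 0 => c X _; exists [::]; rewrite ?sub0seq //; auto.
have [|N1 H1] := IH s t.+1; first by rewrite -ltnS.
have [|N2 H2] := IH s.+1 t; first by move: le_n; rewrite addnS ltnS.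
exists (N1 + N2).+1 => c [|x X] //=; rewrite ltnS => szX.
have szC := count_predC (c x) X.
have [le1|lt1] := leqP N1 (count (c x) X).
  have [|Y sY HY] := H1 c [seq y <- X | c x y]; first by rewrite size_filter.
  have sYX : subseq Y X := subseq_trans sY (filter_subseq _ _).
  case: HY => [/andP[/eqP szY pY]|HY].
    exists (x :: Y); first by rewrite /= eqxx.
    left; rewrite /= szY eqxx pY andbT; apply/allP => y /(mem_subseq sY).
    by rewrite mem_filter => /andP[].
  by exists Y; [exact: subseq_trans sYX (subseq_cons _ _) | right].
have [|Y sY HY] := H2 c [seq y <- X | ~~ c x y].
  rewrite size_filter -(leq_add2l N1); apply: leq_trans szX _.
  by rewrite -szC leq_add2r ltnW.
have sYX : subseq Y X := subseq_trans sY (filter_subseq _ _).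
case: HY => [HY|/andP[/eqP szY pY]].
  by exists Y; [exact: subseq_trans sYX (subseq_cons _ _) | left].
exists (x :: Y); first by rewrite /= eqxx.
right; rewrite /= szY eqxx pY andbT; apply/allP => y /(mem_subseq sY).
by rewrite mem_filter => /andP[].
Qed.

Lemma arrows_exists (G : ordgraph) : exists N, arrows N G.
Proof.
have [N HN] : exists N, forall c : rel nat, forall X : seq nat, N <= size X ->
    exists2 Y, subseq Y X & size Y = nverts G /\
      exists b, pairwise (fun x y => c x y == b) Y.
  have [N HN] := ramsey_seq nat (nverts G) (nverts G).
  exists N => c X /(HN c)[Y sYX HY]; exists Y => //.
  case: HY => /andP[/eqP szY pY]; split=> //; [exists true|exists false];
    by apply: sub_pairwise pY => x y; case: (c x y).
exists N; apply/forallP => chi.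
case: N chi HN => [|N] chi HN.
  have no_vert (u : 'I_(nverts G)) : nverts G = 0 -> False.
    by move=> v0; case: u => u; rewrite v0.
  have [Y /[!subseq0]/eqP-> [/esym v0 _]] := HN (fun _ _ => true) [::] isT.
  apply/existsP; exists [ffun u => cast_ord v0 u].
  apply/andP; split; last first.
    by apply/existsP; exists true; apply/forallP => u; by case: (no_vert u).
  by apply/andP; split; apply/forallP => u; by case: (no_vert u).
have [|Y sY [szY [b pY]]] :=
  HN (fun x y => chi [set inord x; inord y]) (iota 0 N.+1).
  by rewrite size_iota.
have ltY (x : nat) : x \in Y -> x < N.+1.
  by move=> /(mem_subseq sY); rewrite mem_iota.
have stY : pairwise ltn Y.
  rewrite -(sorted_pairwise ltn_trans).
  exact: (subseq_sorted ltn_trans sY (iota_ltn_sorted _ _)).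
pose f := [ffun u : 'I_(nverts G) => inord (nth 0 Y u) : 'I_N.+1].
have fE u : f u = nth 0 Y u :> nat.
  by rewrite ffunE inordK // ltY // mem_nth // szY.
have fI (u v : 'I_(nverts G)) : u < v -> f u < f v.
  move=> lt_uv; rewrite !fE.
  by move/pairwiseP: stY => /(_ 0 u v); apply=> //; rewrite inE szY.
have fC (u v : 'I_(nverts G)) : u < v -> chi [set f u; f v] == b.
  move=> lt_uv; rewrite !ffunE.
  by move/pairwiseP: pY => /(_ 0 u v); apply=> //; rewrite inE szY.
apply/existsP; exists f; apply/andP; split.
  apply/andP; split; apply/forallP => u; apply/forallP => v; apply/implyP.
    exact: fI.
  move=> uv; have: u != v.
    by apply: contraTneq uv => ->; rewrite edge_irrefl.
  rewrite -val_eqE neq_ltn /= /complete_edge -val_eqE neq_ltn /=.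
  by case/orP=> /fI->; rewrite ?orbT.
apply/existsP; exists b; apply/forallP => u; apply/forallP => v.
apply/implyP => uv; have: u != v.
  by apply: contraTneq uv => ->; rewrite edge_irrefl.
by rewrite -val_eqE neq_ltn => /orP[] /fC //; rewrite setUC.
Qed.

Definition ramsey (G : ordgraph) : nat := ex_minn (arrows_exists G).

Definition GP_edge (P : mat01) : rel 'I_(nrows P + ncols P) := fun x y =>
  match split x, split y with
  | inl i, inr k | inr k, inl i => P i k
  | _, _ => false
  end.

Lemma GP_edge_sym P : symmetric (@GP_edge P).
Proof. by move=> x y; rewrite /GP_edge; case: split; case: split. Qed.

Lemma GP_edge_irrefl P : irreflexive (@GP_edge P).
Proof. by move=> x; rewrite /GP_edge; case: split. Qed.

Definition GP (P : mat01) : ordgraph :=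
  OrdGraph (@GP_edge_sym P) (@GP_edge_irrefl P).

(* R(G_{Q_j}) = Theta(v(G_{Q_j})), uniformly in j >= 1. *)
Definition ramsey_linear (Q : nat -> mat01) : Prop :=
  exists c C : nat, forall j : nat, 0 < j ->
    nverts (GP (Q j)) <= c * ramsey (GP (Q j)) /\
    ramsey (GP (Q j)) <= C * nverts (GP (Q j)).

Definition border_one (P : mat01) : Prop :=
  exists i k : nat, entry P i k /\
    [\/ i = 0, i = (nrows P).-1, k = 0 | k = (ncols P).-1].

Inductive border_step (P : mat01) : mat01 -> Prop :=
| NewFirstCol r : entry P r 0 ->
    border_step P (Mat01 (row_mx (\col_(i < nrows P) (i == r :> nat)) P))
| NewLastCol r : entry P r (ncols P).-1 ->
    border_step P (Mat01 (row_mx P (\col_(i < nrows P) (i == r :> nat))))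
| NewFirstRow c : entry P 0 c ->
    border_step P (Mat01 (col_mx (\row_(k < ncols P) (k == c :> nat)) P))
| NewLastRow c : entry P (nrows P).-1 c ->
    border_step P (Mat01 (col_mx P (\row_(k < ncols P) (k == c :> nat)))).

Inductive border_steps (P : mat01) : nat -> mat01 -> Prop :=
| BorderSteps0 : border_steps P 0 P
| BorderStepsS j Q Q' :
    border_steps P j Q -> border_step Q Q' -> border_steps P j.+1 Q'.

(* Inserts m columns between columns c and c+1 of P, each of them having its
   ones exactly in the rows satisfying v. *)
Definition insert_cols (P : mat01) (c m : nat) (v : pred nat) : mat01 :=
  build01 (nrows P) (ncols P + m) (fun i k =>
    if k <= c then entry P i k
    else if k <= c + m then v i
    else entry P i (k - m)).

(* The new first row has its two ones above the empty columns c+1 and c+2. *)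
Definition roof (P : mat01) (c : nat) : mat01 :=
  let Q := insert_cols P c 2 pred0 in
  Mat01 (col_mx (\row_(k < ncols Q) ((k == c.+1 :> nat) || (k == c.+2 :> nat)))
                Q).

(* The bottom right corner of Q is superposed with the top left corner of P. *)
Definition corner_glue (Q P : mat01) : mat01 :=
  let i0 := (nrows Q).-1 in
  let k0 := (ncols Q).-1 in
  build01 (i0 + nrows P) (k0 + ncols P) (fun i k =>
    entry Q i k ||
    [&& i0 <= i, k0 <= k & entry P (i - i0) (k - k0)]).

Definition corner_chain (P : mat01) (j : nat) : mat01 :=
  iter j (fun Q => corner_glue Q P) P.

Definition spread (P : mat01) (j : nat) : mat01 :=
  build01 (nrows P + j * (nrows P).-1) (ncols P + j * (ncols P).-1)
    (fun i k => [&& j.+1 %| i, j.+1 %| k & entry P (i %/ j.+1) (k %/ j.+1)]).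

(* Main.v *)
Require Import Defs.
From mathcomp Require Import all_boot matrix.
From mathcomp Require Import zify.
From mathcomp Require Import boolp.

(** The lower bound holds for every ordered graph, a copy being an injection
(ramsey_lower).  For the upper bound, colour the edges of the complete graph on
2n vertices and look only at the edges between the first n and the last n
vertices: they form an n by n matrix, one of the two colours fills at least half
of it, and a copy of Q in that colour class is a monochromatic copy of GP Q
(dense_arrows).  It is therefore enough that half of the entries of an n by n
matrix force a copy of P_j as soon as n is at least a constant times the size of
P_j, and a bound ex(n, P_j) <= D n with D linear in that size gives this
(ramsey_linear_forces).  In each case the hypothesis ex(n, P) = O(n) is applied
to a matrix B' derived from the given one.

- Border steps: B' has lost the first (or last) one of each row (or column), at
  most n ones; whatever one of the current pattern on the border is chosen, its
  image has a deleted one beyond it, which is the image of the new one.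

- Insertion of columns: B' keeps one in j + 1 ones of each row, so two of them
  in the same row enclose j ones of the original matrix.

- Roof: put m = j + 2 and cut the ones of each row into chunks of 3m + 1.  B'
  keeps the first one of a chunk only if, within the span of the chunk after its
  first one, some higher row has m ones; those form the roof.  A chunk without
  this property is bad.  Call an interval of columns rich when some row above
  the current one has m ones in it.  When the current row is taken into account,
  each bad chunk creates three new disjoint rich intervals and destroys at most
  two members of a disjoint family of rich intervals, since it contains none of
  them and so meets only those which straddle one of its ends.  A disjoint family
  has at most n members, so there are at most n bad chunks (weight_bad).

- Chains: B' consists of the ones which are the top left corner of a copy of P.
  The other ones avoid P, so there are O(n) of them, and any chain found in B'
  can be extended by one more copy.  By induction, (j + 1) C n ones suffice.

- Spreading: some residue class of rows and of columns modulo j + 1 is at least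
  as dense as the whole matrix; a copy of P in it has all gaps at least j + 1.

The matrices in which patterns are sought are represented by functions of two
natural numbers, of which only the values below n matter, and copies by functions
on natural numbers, of which only the values on the positions of the pattern
matter.  Both can then be modified freely, without transport between ordinals. *)

Set Implicit Arguments.
Unset Strict Implicit.
Unset Printing Implicit Defensive.

(** * Counting ones *)

Definition cnt (b : pred nat) (x y : nat) : nat := \sum_(x <= k < y) b k.

Definition weight (n : nat) (B : nat -> pred nat) : nat :=
  \sum_(0 <= i < n) cnt (B i) 0 n.

Lemma cnt_cat (b : pred nat) (x y z : nat) :
  x <= y -> y <= z -> cnt b x z = cnt b x y + cnt b y z.
Proof. by move=> xy yz; rewrite /cnt (big_cat_nat xy yz). Qed.

Lemma cntS (b : pred nat) (x y : nat) :
  x <= y -> cnt b x y.+1 = cnt b x y + b y.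
Proof. by move=> xy; rewrite /cnt big_nat_recr. Qed.

Lemma cnt_ltn (b : pred nat) (x y : nat) :
  x < y -> cnt b x y = b x + cnt b x.+1 y.
Proof. by move=> xy; rewrite /cnt big_ltn. Qed.

Lemma cnt_geq (b : pred nat) (x y : nat) : y <= x -> cnt b x y = 0.
Proof. by move=> yx; rewrite /cnt big_geq. Qed.

Lemma cnt_widen (b : pred nat) (x x' y y' : nat) :
  x' <= x -> y <= y' -> cnt b x y <= cnt b x' y'.
Proof.
move=> x'x yy'; have [xy|yx] := leqP x y; last by rewrite cnt_geq // ltnW.
by rewrite (cnt_cat b x'x (leq_trans xy yy')) (cnt_cat b xy yy') addnCA leq_addr.
Qed.

Lemma cnt_gt0 (b : pred nat) (x y : nat) :
  0 < cnt b x y -> exists k, [/\ x <= k, k < y & b k].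
Proof.
rewrite lt0n sum_nat_seq_neq0 => /hasP[k].
by rewrite mem_index_iota => /andP[xk ky] /=; rewrite eqb0 negbK; exists k.
Qed.

(** Counts grow by steps of at most one, so every value is attained. *)
Lemma cnt_ivt (b : pred nat) (m x y : nat) : x <= y -> m <= cnt b x y ->
  exists z, [/\ x <= z, z <= y & cnt b x z = m].
Proof.
elim: y => [|y IHy] xy m_le.
  by exists x; split=> //; move: m_le; rewrite !cnt_geq // leqn0 => /eqP.
have [lt_m|m_eq] := ltnP m (cnt b x y.+1); last first.
  by exists y.+1; split=> //; apply/eqP; rewrite eqn_leq m_eq.
have {}xy : x <= y.
  by rewrite leqNgt; apply/negP => yx; rewrite cnt_geq in lt_m.
have [|z [xz zy <-]] := IHy xy; last by exists z; split=> //; apply: leqW.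
by move: lt_m; rewrite cntS //; case: (b y); lia.
Qed.

Lemma cnt_le1 (b : pred nat) (n : nat) :
  (forall k k', k < k' -> k' < n -> b k -> b k' -> False) -> cnt b 0 n <= 1.
Proof.
elim: n => [|n IHn] b1; first by rewrite cnt_geq.
rewrite cntS //; have [bn|_] := boolP (b n); last first.
  by rewrite addn0; apply: IHn => k k' kk' k'n; apply: b1; lia.
rewrite (_ : cnt b 0 n = 0) //; apply/eqP; rewrite -leqn0 leqNgt.
by apply/negP => /cnt_gt0[k [_ kn bk]]; apply: (b1 k n).
Qed.

Lemma sum_le_length (f : nat -> nat) (n : nat) :
  (forall k, k < n -> f k <= 1) -> \sum_(0 <= k < n) f k <= n.
Proof.
move=> f1; apply: leq_trans (_ : \sum_(0 <= k < n) 1 <= n).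
  by rewrite !big_nat; apply: leq_sum => k /andP[_ /f1].
by rewrite sum_nat_const_nat subn0 muln1.
Qed.

Lemma weight_gt0 (n : nat) (B : nat -> pred nat) :
  0 < weight n B -> exists x y, [/\ x < n, y < n & B x y].
Proof.
rewrite lt0n sum_nat_seq_neq0 => /hasP[x].
rewrite mem_index_iota => /andP[_ xn] /=; rewrite -lt0n => /cnt_gt0[y [_ yn Bxy]].
by exists x, y.
Qed.

Lemma weight_sub (n : nat) (B B1 B2 : nat -> pred nat) :
  (forall i k, i < n -> k < n -> B i k -> B1 i k || B2 i k) ->
  weight n B <= weight n B1 + weight n B2.
Proof.
move=> sub; rewrite /weight -big_split /= !big_nat; apply: leq_sum => i.
move=> /andP[_ i_n]; rewrite /cnt -big_split /= !big_nat; apply: leq_sum => k.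
move=> /andP[_ k_n]; move: (sub i k i_n k_n).
by case: (B i k); case: (B1 i k); case: (B2 i k) => //= /(_ isT).
Qed.

Lemma weight_tr (n : nat) (B : nat -> pred nat) :
  weight n (fun k i => B i k) = weight n B.
Proof. exact: exchange_big_nat. Qed.

Lemma weight_rows (n : nat) (B : nat -> pred nat) :
  (forall i, i < n -> cnt (B i) 0 n <= 1) -> weight n B <= n.
Proof. exact: sum_le_length. Qed.

Lemma weight_scale (s n : nat) (B B' : nat -> pred nat) :
  (forall i, cnt (B i) 0 n <= s * cnt (B' i) 0 n) ->
  weight n B <= s * weight n B'.
Proof. by move=> BB'; rewrite /weight big_distrr /=; apply: leq_sum. Qed.

(** * Copies of a pattern *)

(** The row map, or the column map, of a copy. *)
Definition placement (a n : nat) (F : nat -> nat) : Prop :=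
  (forall i i', i < i' -> i' < a -> F i < F i') /\ (forall i, i < a -> F i < n).

Lemma placement_widen (a n n' : nat) (F : nat -> nat) :
  n <= n' -> placement a n F -> placement a n' F.
Proof. by move=> nn' [F_i F_n]; split=> // i /F_n Fi; apply: leq_trans nn'. Qed.

Lemma placement_leq (a n : nat) (F : nat -> nat) (i i' : nat) :
  placement a n F -> i <= i' -> i' < a -> F i <= F i'.
Proof.
by move=> [F_i _]; rewrite leq_eqVlt => /orP[/eqP->|ii' /(F_i _ _ ii')/ltnW].
Qed.

Lemma placement_id (a n : nat) (F : nat -> nat) :
  placement a n F -> forall i, i < a -> i <= F i.
Proof.
case=> F_i _; elim=> // i IHi ia.
exact: leq_ltn_trans (IHi (ltnW ia)) (F_i i i.+1 (ltnSn i) ia).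
Qed.

Lemma placement_cons (a n x : nat) (F : nat -> nat) :
  placement a n F -> x < n -> (0 < a -> x < F 0) ->
  placement (1 + a) n (fun i => if i is i'.+1 then F i' else x).
Proof.
move=> [F_i F_n] xn xF; split=> [[|i] [|i'] //|[|i] //]; last exact: F_n.
  case: i' => [_ /xF //|i' _ i'a].
  by apply: ltn_trans (F_i 0 i'.+1 isT i'a); apply: xF; lia.
by move=> ii' i'a; apply: F_i.
Qed.

Lemma placement_rcons (a n x : nat) (F : nat -> nat) :
  placement a n F -> x < n -> (0 < a -> F a.-1 < x) ->
  placement (a + 1) n (fun i => if i < a then F i else x).
Proof.
move=> [F_i F_n] xn xF; split=> [i i' ii' i'a|i ia]; last first.
  by case: (ltnP i a) => [/F_n|_].
case: (ltnP i a) => ia; last by lia.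
case: (ltnP i' a) => [|_]; first exact: F_i.
have [->|ia1] : i = a.-1 \/ i < a.-1 by lia.
  by apply: xF; lia.
by apply: ltn_trans (F_i i a.-1 _ _) (xF _); lia.
Qed.

(** The columns of the ones, as a placement, so that they can serve as images of
consecutive columns of a pattern. *)
Lemma cnt_select (b : pred nat) (m x y : nat) : m <= cnt b x y ->
  exists2 T, placement m y T & forall l, l < m -> x <= T l /\ b (T l).
Proof.
elim: y m => [|y IHy] m.
  by rewrite cnt_geq // leqn0 => /eqP->; exists id.
have [xy|yx] := leqP x y; last first.
  by rewrite cnt_geq // leqn0 => /eqP->; exists id.
rewrite cntS // => m_le; have [m_le'|lt_m] := leqP m (cnt b x y).
  have [T Tpl Tb] := IHy m m_le'; exists T => //.
  exact: placement_widen (leqnSn y) Tpl.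
case: m m_le lt_m => // m m_le lt_m.
have [|T Tpl Tb] := IHy m; first by case: (b y) m_le; lia.
have b_y : b y by case: (b y) m_le; lia.
exists (fun l => if l < m then T l else y).
  rewrite -addn1; apply: placement_rcons => //.
    exact: placement_widen (leqnSn y) Tpl.
  by move=> m0; apply: Tpl.2; lia.
by move=> l lm; case: (ltnP l m) => [/Tb|].
Qed.

Definition occurs (n : nat) (B : nat -> pred nat) (P : mat01)
    (F G : nat -> nat) : Prop :=
  [/\ placement (nrows P) n F, placement (ncols P) n G
    & forall i k, entry P i k -> B (F i) (G k)].

(** An upper bound D n on the extremal function, for n >= n0, in the form in which
it is applied: to functions instead of matrices, and without a maximum. *)
Definition forces (P : mat01) (D n0 : nat) : Prop :=
  forall n B, n0 <= n -> D * n < weight n B -> exists F G, occurs n B P F G.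

(** What the two-colouring argument needs of [P] at size [n]: one of two
complementary matrices always has half of the entries. *)
Definition dense (n : nat) (P : mat01) : Prop :=
  forall B, n * n <= 2 * weight n B -> exists F G, occurs n B P F G.

Lemma forces_mono (P : mat01) (C D n0 n1 : nat) :
  C <= D -> n0 <= n1 -> forces P C n0 -> forces P D n1.
Proof.
move=> CD n01 forP n B n1n wB; apply: forP; first exact: leq_trans n1n.
by apply: leq_ltn_trans wB; rewrite leq_mul2r CD orbT.
Qed.

Lemma forces_dense (P : mat01) (D n0 n : nat) :
  forces P D n0 -> n0 <= n -> 2 * D < n -> dense n P.
Proof. by move=> forP n0n Dn B wB; apply: forP => //; nia. Qed.

(** One position is enough for the at most one entry of [Q].  Such
patterns do not grow under glueing and spreading, so their bound must not grow
with j either. *)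
Lemma forces_small (Q : mat01) :
  nrows Q <= 1 -> ncols Q <= 1 -> forces Q 0 0.
Proof.
move=> a1 b1 n B _; rewrite mul0n => /weight_gt0[x [y [xn yn Bxy]]].
by exists (fun _ => x), (fun _ => y); split=> //; split=> // i i'; lia.
Qed.

(** * Entries of matrices *)

Lemma entryE (P : mat01) (i : 'I_(nrows P)) (k : 'I_(ncols P)) :
  entry P i k = P i k.
Proof. by rewrite /entry !valK. Qed.

Lemma entry_bound (P : mat01) (i k : nat) :
  entry P i k -> i < nrows P /\ k < ncols P.
Proof. by rewrite /entry; case: insubP => // ? ? _; case: insubP. Qed.

Lemma entry_build01 (a b : nat) (F : nat -> nat -> bool) (i k : nat) :
  entry (build01 a b F) i k = [&& i < a, k < b & F i k].
Proof.
rewrite /entry /=; case: insubP => /= [i' -> <-|/negPf->] //.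
by case: insubP => /= [k' -> <-|/negPf->] //; rewrite mxE.
Qed.

Lemma entry_row_mx (m a b : nat) (A : 'M[bool]_(m, a)) (B : 'M[bool]_(m, b))
    (i k : nat) :
  entry (Mat01 (row_mx A B)) i k =
  if k < a then entry (Mat01 A) i k else entry (Mat01 B) i (k - a).
Proof.
rewrite /entry /=; case: insubP => /= [i' _ _|_]; last by case: ifP.
case: (ltnP k a) => [ka|ak].
  rewrite !insubT /= => [|kab]; first by rewrite ltn_addr.
  have ->: Sub k kab = lshift b (Sub k ka) by apply: val_inj.
  by rewrite row_mxEl.
case: insubP => /= [k' kab k'E|/negPf kab]; last first.
  by rewrite insubF // -kab; apply/idP/idP; lia.
rewrite insubT /= => [|kb]; first by lia.
have ->: k' = rshift a (Sub (k - a) kb) by apply: val_inj; rewrite /= k'E; lia.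
by rewrite row_mxEr.
Qed.

Lemma entry_tr (m a : nat) (A : 'M[bool]_(m, a)) (i k : nat) :
  entry (Mat01 A^T) i k = entry (Mat01 A) k i.
Proof.
rewrite /entry /=; case: insubP => /= [i' _ _|_]; case: insubP => //= k' _ _.
by rewrite mxE.
Qed.

Lemma entry_col_mx (m a b : nat) (A : 'M[bool]_(a, m)) (B : 'M[bool]_(b, m))
    (i k : nat) :
  entry (Mat01 (col_mx A B)) i k =
  if i < a then entry (Mat01 A) i k else entry (Mat01 B) (i - a) k.
Proof. by rewrite -entry_tr tr_col_mx entry_row_mx !entry_tr. Qed.

Lemma entry_row (m : nat) (b : pred nat) (i k : nat) :
  entry (Mat01 (\row_(k < m) b k)) i k -> i = 0 /\ b k.
Proof.
rewrite /entry /=; case: insubP => //= i' _ <-; case: insubP => //= k' _ <-.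
by rewrite mxE => ->; rewrite ord1.
Qed.

Lemma entry_col (m : nat) (b : pred nat) (i k : nat) :
  entry (Mat01 (\col_(i < m) b i)) i k -> k = 0 /\ b i.
Proof.
rewrite /entry /=; case: insubP => //= i' _ <-; case: insubP => //= k' _ <-.
by rewrite mxE => ->; rewrite ord1.
Qed.

(** * Extremal bounds and Ramsey numbers *)

Lemma placement_ffun (a n : nat) (F : nat -> nat) : placement a n F ->
  exists2 f : {ffun 'I_a -> 'I_n}, increasing f & forall i, f i = F i :> nat.
Proof.
case=> Fi Fn; exists [ffun i : 'I_a => Ordinal (Fn i (ltn_ord i))].
  apply/forallP => x; apply/forallP => y; apply/implyP => xy.
  by rewrite !ffunE /=; apply: Fi.
by move=> i; rewrite ffunE.
Qed.

Lemma ffun_placement (a n : nat) (f : {ffun 'I_a -> 'I_n}) : increasing f ->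
  exists2 F, placement a n F & forall i, f i = F i :> nat.
Proof.
move=> /forallP f_incr.
pose F i := if insub i is Some i' then nat_of_ord (f i') else 0.
have FE (i : 'I_a) : f i = F i :> nat by rewrite /F valK.
exists F => //; split=> [i i' ii' i'a|i ia]; last by rewrite -(FE (Ordinal ia)).
have ia := ltn_trans ii' i'a.
rewrite -(FE (Ordinal ia)) -(FE (Ordinal i'a)).
by have /forallP/(_ (Ordinal i'a))/implyP := f_incr (Ordinal ia); apply.
Qed.

Lemma containsP (n : nat) (A : 'M[bool]_n) (P : mat01) :
  reflect (exists F G, occurs n (entry (Mat01 A)) P F G) (contains (Mat01 A) P).
Proof.
apply: (iffP idP) => [/existsP[f /existsP[g /and3P[f_i g_i /forallP fg]]]|].
  have [F Fpl FE] := ffun_placement f_i; have [G Gpl GE] := ffun_placement g_i.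
  exists F, G; split=> // i k Pik; have [ia kb] := entry_bound Pik.
  move: Pik; rewrite -[i]/(val (Ordinal ia)) -[k]/(val (Ordinal kb)) entryE.
  rewrite -FE -GE (@entryE (Mat01 A)) => Pik.
  by have /forallP/(_ (Ordinal kb)) := fg (Ordinal ia); rewrite Pik mxE.
move=> [F [G [/placement_ffun[f f_i fE] /placement_ffun[g g_i gE] FG]]].
apply/existsP; exists f; apply/existsP; exists g; rewrite f_i g_i /=.
apply/forallP => i; apply/forallP => k; apply/implyP => Pik.
by rewrite mxE -(@entryE (Mat01 A)) fE gE; apply: FG; rewrite entryE.
Qed.

Lemma ones_weight (n : nat) (A : 'M[bool]_n) (B : nat -> pred nat) :
  (forall i k : 'I_n, B i k = A i k) -> ones A = weight n B.
Proof.
move=> AB; rewrite /ones /weight big_mkord.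
under eq_bigr => i _ do rewrite /cnt big_mkord.
rewrite pair_big /= -sum1_card big_mkcond /=.
by apply: eq_bigr => -[i k] _; rewrite inE /= AB; case: (A i k).
Qed.

Lemma ex_linear_forces (P : mat01) :
  ex_linear P -> exists C n0, forces P C n0.
Proof.
move=> [C [n0 exP]]; exists C, n0 => n B n0n wB.
pose A : 'M[bool]_n := build01 n n B.
have [/containsP[F [G [Fpl Gpl FG]]]|nAP] := boolP (contains (Mat01 A) P).
  exists F, G; split=> // i k /FG.
  by rewrite (entry_build01 n n) => /and3P[].
suff : ones A <= C * n.
  by rewrite (@ones_weight _ _ B) => [|i k]; rewrite ?mxE //; lia.
apply: leq_trans (exP n n0n).
exact: (leq_bigmax_cond (F := fun A : 'M[bool]_n => ones A)).
Qed.

(** The colour classes of the edges between the first [n] and the last [n]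
vertices are complementary n by n matrices. *)
Lemma dense_arrows (n : nat) (Q : mat01) : dense n Q -> arrows (n + n) (GP Q).
Proof.
move=> dQ; apply/forallP => chi.
pose e (b : bool) : 'M[bool]_n :=
  (\matrix_(i, k) (chi [set lshift n i; rshift n k] == b))%R.
pose B b := entry (Mat01 (e b)).
have eB b (i k : 'I_n) : B b i k = e b i k by rewrite /B (@entryE (Mat01 _)).
have [b [F [G [Fpl Gpl FG]]]] : exists b F G, occurs n (B b) Q F G.
  have sumB : n * n <= weight n (B true) + weight n (B false).
    apply: leq_trans (weight_sub (B := fun _ _ => true) _).
      rewrite /weight /cnt; under eq_bigr => i _ do rewrite sum_nat_const_nat.
      by rewrite sum_nat_const_nat; lia.
    move=> i k i_n k_n _.
    rewrite -[i]/(val (Ordinal i_n)) -[k]/(val (Ordinal k_n)) !eB !mxE.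
    by case: (chi _).
  have [Ht|Hf] := leqP (n * n) (2 * weight n (B true)).
    by exists true; apply: dQ.
  by exists false; apply: dQ; lia.
have [f f_i fE] := placement_ffun Fpl; have [g g_i gE] := placement_ffun Gpl.
pose h (x : 'I_(nrows Q + ncols Q)) : 'I_(n + n) :=
  match split x with inl i => lshift n (f i) | inr k => rshift n (g k) end.
have h_incr (x y : 'I_(nrows Q + ncols Q)) : x < y -> h x < h y.
  rewrite /h; case: (split_ordP x) => i ->; case: (split_ordP y) => k -> /=.
  - by move=> ik; have /forallP/(_ k)/implyP := forallP f_i i; apply.
  - by move=> _; apply: ltn_addr.
  - by have := ltn_ord k; lia.
  - rewrite !ltn_add2l => ik.
    by have /forallP/(_ k)/implyP := forallP g_i i; apply.
have hQ i k : Q i k -> chi [set lshift n (f i); rshift n (g k)] = b.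
  move=> Qik; have := FG i k; rewrite entryE => /(_ Qik).
  by rewrite -fE -gE eB mxE => /eqP.
apply/existsP; exists (finfun h); apply/andP; split.
  apply/andP; split; apply/forallP => u; apply/forallP => v; apply/implyP.
    by rewrite !ffunE; apply: h_incr.
  move=> uv; rewrite /= /complete_edge !ffunE.
  have: u != v by apply: contraTneq uv => ->; rewrite edge_irrefl.
  rewrite -val_eqE neq_ltn => /orP[] /h_incr huv;
    by rewrite -val_eqE neq_ltn huv ?orbT.
apply/existsP; exists b; apply/forallP => u; apply/forallP => v; apply/implyP.
rewrite !ffunE /= /GP_edge /h.
case: (split u) => i; case: (split v) => k // /hQ; first by move=> ->.
by rewrite setUC => ->.
Qed.

Lemma increasing_leq (m n : nat) (f : {ffun 'I_m -> 'I_n}) :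
  increasing f -> m <= n.
Proof.
move=> /ffun_placement[F Fpl _]; case: m Fpl {f} => // m Fpl.
exact: leq_ltn_trans (placement_id Fpl (ltnSn m)) (Fpl.2 m (ltnSn m)).
Qed.

Lemma arrows_leq (N : nat) (G : ordgraph) : arrows N G -> nverts G <= N.
Proof.
move=> /forallP/(_ [ffun=> true])/existsP[f /andP[/andP[f_i _] _]].
exact: increasing_leq f_i.
Qed.

Lemma ramsey_lower (G : ordgraph) : nverts G <= ramsey G.
Proof. by rewrite /ramsey; case: ex_minnP => N /arrows_leq. Qed.

Lemma ramsey_upper (N : nat) (G : ordgraph) : arrows N G -> ramsey G <= N.
Proof. by rewrite /ramsey => arrN; case: ex_minnP => M _; apply. Qed.

Lemma ramsey_linear_dense (Q : nat -> mat01) :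
  (exists K, forall j, 0 < j ->
     exists2 n, n <= K * nverts (GP (Q j)) & dense n (Q j)) ->
  ramsey_linear Q.
Proof.
move=> [K HK]; exists 1, (2 * K) => j j0; rewrite mul1n; split.
  exact: ramsey_lower.
have [n nK /dense_arrows/ramsey_upper Rn] := HK j j0.
by apply: leq_trans Rn _; rewrite -mulnA mul2n -addnn leq_add.
Qed.

(** Take n = (2K + 1) v, with v the number of vertices: half of n^2 exceeds K v n. *)
Lemma ramsey_linear_forces (Q : nat -> mat01) (K : nat) :
  (forall j, 0 < j -> 0 < nverts (GP (Q j)) /\
     forces (Q j) (K * nverts (GP (Q j))) (K * nverts (GP (Q j)))) ->
  ramsey_linear Q.
Proof.
move=> HK; apply: ramsey_linear_dense; exists (2 * K).+1 => j j0.
have [v0 forQ] := HK j j0.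
by exists ((2 * K).+1 * nverts (GP (Q j))) => //; apply: forces_dense forQ _ _; nia.
Qed.

(** * Rows and columns attached to the border *)

Lemma weight_drop (n : nat) (B B' : nat -> pred nat) :
  (forall i, i < n -> cnt (fun k => B i k && ~~ B' i k) 0 n <= 1) ->
  weight n B <= weight n B' + n.
Proof.
move=> /(@weight_rows n (fun i k => B i k && ~~ B' i k)) drop.
apply: leq_trans (leq_add (leqnn _) drop).
by apply: weight_sub => i k _ _ ->; rewrite orbN.
Qed.

Lemma weight_drop_cols (n : nat) (B B' : nat -> pred nat) :
  (forall k, k < n -> cnt (fun i => B i k && ~~ B' i k) 0 n <= 1) ->
  weight n B <= weight n B' + n.
Proof. by rewrite -(weight_tr n B) -(weight_tr n B'); apply: weight_drop. Qed.

(** Only the first one has no other one before it. *)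
Lemma cnt_first_le1 (b : pred nat) (n : nat) :
  cnt (fun k => b k && ~~ (b k && (0 < cnt b 0 k))) 0 n <= 1.
Proof.
apply: cnt_le1 => k k' kk' _ /andP[bk _] /andP[-> /=].
by have := cnt_cat b (leq0n k) (ltnW kk'); have := cnt_ltn b kk'; rewrite bk; lia.
Qed.

Lemma cnt_last_le1 (b : pred nat) (n : nat) :
  cnt (fun k => b k && ~~ (b k && (0 < cnt b k.+1 n))) 0 n <= 1.
Proof.
apply: cnt_le1 => k k' kk' k'n /andP[-> /= last_k] /andP[bk' _].
by have := cnt_cat b kk' (ltnW k'n); have := cnt_ltn b k'n; rewrite bk'; lia.
Qed.

(** Delete from each row or column its extreme one on the side of the new line.
In a copy of [Q] in the rest, the image of the entry next to the new one is then
not extreme in its row or column, and a one further out is the image of the new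
one. *)
Lemma forces_border_step (Q Q' : mat01) (D n0 : nat) :
  border_step Q Q' -> forces Q D n0 -> forces Q' D.+1 n0.
Proof.
move=> QQ' forQ n B n0n wB.
have find B' : weight n B <= weight n B' + n -> exists F G, occurs n B' Q F G.
  by move=> wB'; apply: forQ => //; lia.
case: QQ' => [r Qr|r Qr|c Qc|c Qc].
- have [|F [G [Fpl Gpl FG]]] := find (fun i k => B i k && (0 < cnt (B i) 0 k)).
    by apply: weight_drop => i _; apply: cnt_first_le1.
  have /andP[_ /cnt_gt0[y [_ yG By]]] := FG _ _ Qr.
  have [_ b0] := entry_bound Qr.
  exists F, (fun k => if k is k'.+1 then G k' else y); split=> //.
    by apply: placement_cons => //; apply: ltn_trans yG (Gpl.2 _ b0).
  move=> i k; rewrite entry_row_mx; case: ltnP => k1.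
    by case/(@entry_col _ (pred1 r))=> -> /eqP->.
  by case: k k1 => // k _; rewrite subn1 => /FG/andP[].
- have [|F [G [Fpl Gpl FG]]] := find (fun i k => B i k && (0 < cnt (B i) k.+1 n)).
    by apply: weight_drop => i _; apply: cnt_last_le1.
  have /andP[_ /cnt_gt0[y [Gy yn By]]] := FG _ _ Qr.
  exists F, (fun k => if k < ncols Q then G k else y); split=> //.
    exact: placement_rcons.
  move=> i k; rewrite entry_row_mx; case: ltnP => kQ; first by case/FG/andP.
  by case/(@entry_col _ (pred1 r))=> _ /eqP->.
- have [|F [G [Fpl Gpl FG]]] :=
    find (fun i k => B i k && (0 < cnt (B^~ k) 0 i)).
    by apply: weight_drop_cols => k _; apply: cnt_first_le1.
  have /andP[_ /cnt_gt0[x [_ xF Bx]]] := FG _ _ Qc.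
  have [a0 _] := entry_bound Qc.
  exists (fun i => if i is i'.+1 then F i' else x), G; split=> //.
    by apply: placement_cons => //; apply: ltn_trans xF (Fpl.2 _ a0).
  move=> i k; rewrite entry_col_mx; case: ltnP => i1.
    by case/(@entry_row _ (pred1 c))=> -> /eqP->.
  by case: i i1 => // i _; rewrite subn1 => /FG/andP[].
- have [|F [G [Fpl Gpl FG]]] :=
    find (fun i k => B i k && (0 < cnt (B^~ k) i.+1 n)).
    by apply: weight_drop_cols => k _; apply: cnt_last_le1.
  have /andP[_ /cnt_gt0[x [Fx xn Bx]]] := FG _ _ Qc.
  exists (fun i => if i < nrows Q then F i else x), G; split=> //.
    exact: placement_rcons.
  move=> i k; rewrite entry_col_mx; case: ltnP => iQ; first by case/FG/andP.
  by case/(@entry_row _ (pred1 c))=> _ /eqP->.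
Qed.

Lemma forces_border_steps (P Q : mat01) (j D n0 : nat) :
  border_steps P j Q -> forces P D n0 -> forces Q (D + j) n0.
Proof.
move=> PQ forP; elim: PQ => [|{}j Q1 Q2 _ IH Q12]; first by rewrite addn0.
by rewrite addnS; apply: forces_border_step Q12 IH.
Qed.

Lemma border_steps_nverts (P Q : mat01) (j : nat) :
  border_steps P j Q -> nverts (GP Q) = nverts (GP P) + j.
Proof.
elim=> [|{}j Q1 Q2 _ IH]; first by rewrite addn0.
by case=> [r _|r _|c _|c _]; move: IH => /=; lia.
Qed.

Lemma ramsey_linear_border_steps (P : mat01) (Q : nat -> mat01) (C n0 : nat) :
  forces P C n0 -> (forall j, 0 < j -> border_steps P j (Q j)) ->
  ramsey_linear Q.
Proof.
move=> forP PQ; apply: (@ramsey_linear_forces _ (C.+1 + n0)) => j j0.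
have vQ := border_steps_nverts (PQ j j0); split; first by lia.
apply: forces_mono (forces_border_steps (PQ j j0) forP); rewrite vQ; nia.
Qed.

(** * Columns inserted between two adjacent ones *)

(** The index map of a pattern into which [m] lines have been inserted after line
[c]: [F] on the old lines and [T] on the new ones. *)
Definition insert (c m : nat) (F T : nat -> nat) (k : nat) : nat :=
  if k <= c then F k else if k <= c + m then T (k - c.+1) else F (k - m).

Lemma placement_insert (a n c m : nat) (F T : nat -> nat) :
  placement a n F -> c.+1 < a -> placement m n T ->
  (forall l, l < m -> F c < T l < F c.+1) ->
  placement (a + m) n (insert c m F T).
Proof.
move=> Fpl ca Tpl FTF; rewrite /insert; split=> [i i' ii' i'am|i iam]; last first.
  case: (leqP i c) => ic; first by apply: Fpl.2; lia.
  by case: (leqP i (c + m)) => icm; [apply: Tpl.2; lia | apply: Fpl.2; lia].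
case: (leqP i c) => ic.
  have Fi : F i <= F c by apply: placement_leq Fpl _ _; lia.
  case: (leqP i' c) => i'c; first by apply: Fpl.1 => //; lia.
  case: (leqP i' (c + m)) => i'cm; last by apply: Fpl.1; lia.
  by have /andP[] : F c < T (i' - c.+1) < F c.+1 by [apply: FTF; lia]; lia.
case: (leqP i' c) => i'c; first by lia.
case: (leqP i (c + m)) => icm; case: (leqP i' (c + m)) => i'cm.
- by apply: Tpl.1; lia.
- have /andP[_ lt] : F c < T (i - c.+1) < F c.+1 by apply: FTF; lia.
  by apply: leq_trans lt _; apply: placement_leq Fpl _ _; lia.
- by lia.
- by apply: Fpl.1; lia.
Qed.

(** The first ones of the chunks when the ones of [b] are cut into chunks of [s]. *)
Definition leader (b : pred nat) (s k : nat) : bool := b k && (s %| cnt b 0 k).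

(** The number of chunks is the number of ones divided by [s], rounded up: an
incomplete last chunk has a leader as well. *)
Lemma leaders_many (b : pred nat) (s n : nat) :
  0 < s -> cnt b 0 n <= s * cnt (leader b s) 0 n.
Proof.
move=> s0; elim: n => [|n IHn]; first by rewrite cnt_geq.
rewrite !cntS // {2}/leader; case: (b n) => /=; last by rewrite !addn0.
have [_|ndiv] := boolP (s %| _); first by rewrite mulnDr muln1 leq_add.
rewrite addn0 addn1 ltn_neqAle IHn andbT; apply: contraNneq ndiv => ->.
exact: dvdn_mulr.
Qed.

Lemma leaders_gap (b : pred nat) (s x y : nat) :
  leader b s x -> leader b s y -> x < y -> s <= cnt b x y.
Proof.
move=> /andP[bx sx] /andP[_ sy] xy; apply: dvdn_leq.
  by rewrite cnt_ltn // bx.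
by move: sy; rewrite (cnt_cat b (leq0n x) (ltnW xy)) dvdn_addr.
Qed.

(** Between two leaders for chunks of [j.+1] ones there are [j] further ones of
their row. *)
Lemma forces_insert_cols (P : mat01) (r c j C n0 : nat) :
  forces P C n0 -> entry P r c -> entry P r c.+1 ->
  forces (insert_cols P c j (pred1 r)) (C * j.+1) n0.
Proof.
move=> forP Prc PrcS n B n0n wB.
have [|F [G [Fpl Gpl FG]]] := forP n (fun i => leader (B i) j.+1) n0n.
  have := weight_scale (fun i => leaders_many (B i) n (ltn0Sn j)); nia.
have [_ cP] := entry_bound PrcS.
have Gcc : G c < G c.+1 by apply: Gpl.1.
have gap := leaders_gap (FG _ _ Prc) (FG _ _ PrcS) Gcc.
have [|T Tpl TB] := @cnt_select (B (F r)) j (G c).+1 (G c.+1).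
  by move: gap; rewrite cnt_ltn //; case: (B _ _); lia.
exists F, (insert c j G T); split=> //.
  apply: placement_insert => // [|l lj].
    exact: placement_widen (ltnW (Gpl.2 _ cP)) Tpl.
  by rewrite (TB l lj).1 Tpl.2.
move=> i k; rewrite entry_build01 /insert => /and3P[_ _].
case: (leqP k c) => kc; first by case/FG/andP.
case: (leqP k (c + j)) => kcj; last by case/FG/andP.
by move=> /eqP->; apply: (TB _ _).2; lia.
Qed.

Lemma ramsey_linear_insert_cols (P : mat01) (r c C n0 : nat) :
  forces P C n0 -> entry P r c -> entry P r c.+1 ->
  ramsey_linear (fun j => insert_cols P c j (pred1 r)).
Proof.
move=> forP Prc PrcS; have [a0 b0] := entry_bound PrcS.
apply: (@ramsey_linear_forces _ (C + n0)) => j _.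
have jv : j < nverts (GP (insert_cols P c j (pred1 r))) by move=> /=; lia.
split; first exact: leq_ltn_trans jv.
by apply: forces_mono (forces_insert_cols forP Prc PrcS); nia.
Qed.

(** * Packings of rich intervals *)

(** [t] consecutive half-open intervals in [R], starting at [x] and contained in
x <= k < y.  As [R] will be closed under enlargement, a family of disjoint
intervals may always be made consecutive, so this measures the maximal number of
disjoint intervals in [R]. *)
Fixpoint packs (R : nat -> nat -> Prop) (t x y : nat) : Prop :=
  if t is t'.+1 then exists2 z, R x z & packs R t' z y else x <= y.

Definition widening (R : nat -> nat -> Prop) : Prop :=
  (forall x y, R x y -> x < y) /\
  (forall x x' y y', x' <= x -> y <= y' -> R x y -> R x' y').

Lemma packs_length (R : nat -> nat -> Prop) (t x y : nat) :
  widening R -> packs R t x y -> x + t <= y.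
Proof.
move=> [R_lt _]; elim: t x => [|t IHt] x /=; first by rewrite addn0.
by move=> [z /R_lt xz /IHt]; lia.
Qed.

Lemma packs_weaken (R : nat -> nat -> Prop) (t t' x x' y : nat) :
  widening R -> t' <= t -> x' <= x -> packs R t x y -> packs R t' x' y.
Proof.
move=> wR; elim: t' t x x' => [|t' IHt] [|t] x x' //= t't x'x.
- exact: leq_trans.
- by move=> /(@packs_length _ t.+1 _ _ wR); lia.
- move=> [z Rxz ptz]; exists z; first exact: wR.2 x'x (leqnn z) Rxz.
  exact: IHt ptz.
Qed.

Lemma packs_mono (R R' : nat -> nat -> Prop) (t x y : nat) :
  (forall x y, R x y -> R' x y) -> packs R t x y -> packs R' t x y.
Proof. by move=> RR'; elim: t x => // t IHt x [z /RR' ? /IHt]; exists z. Qed.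

Lemma packs_cat (R : nat -> nat -> Prop) (t t' x y z : nat) :
  widening R -> packs R t x y -> packs R t' y z -> packs R (t + t') x z.
Proof.
move=> wR; elim: t x => [|t IHt] x /= => [xy|[w Rxw /IHt ptw] /ptw]; last first.
  by exists w.
exact: packs_weaken.
Qed.

(** Only one member of the family can straddle [y]. *)
Lemma packs_split (R : nat -> nat -> Prop) (t x y z : nat) :
  widening R -> packs R t x z -> x <= y -> y <= z ->
  exists t1 t2, [/\ packs R t1 x y, packs R t2 y z & t <= t1 + t2 + 1].
Proof.
move=> wR; elim: t x => [|t IHt] x /=; first by exists 0, 0.
move=> [w Rxw ptw] xy yz; have [wy|yw] := leqP w y.
  have [t1 [t2 [p1 p2 le_t]]] := IHt w ptw wy yz.
  by exists t1.+1, t2; split=> //; exists w.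
exists 0, t; split=> //; first exact: packs_weaken (leqnn t) (ltnW yw) ptw.
by rewrite add0n addn1.
Qed.

(** The gain of a row.  A bad position [p] comes with an interval from [p.+1] to
[e] that contains no member of [R] but three consecutive members of [R'].
Cutting a family in [R] at both ends of that interval loses at most two members,
and nothing of it remains inside; the three new members give a net gain of one.
The position [p] from which bad positions are counted is separate from the
start [x] of the family, because the family is only to be cut at bad positions. *)
Lemma packs_row (R R' : nat -> nat -> Prop) (bad : pred nat) (n : nat) :
  widening R -> widening R' -> (forall x y, R x y -> R' x y) ->
  (forall p, p < n -> bad p -> exists e,
     [/\ p < e, e <= n, ~ R p.+1 e, packs R' 3 p.+1 e & cnt bad p.+1 e = 0]) ->
  forall t x p, x <= p -> p <= n ->
    packs R t x n -> packs R' (t + cnt bad p n) x n.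
Proof.
move=> wR wR' RR' badP t x p; have [d] := ubnP (n - p).
elim: d t x p => // d IHd t x p lt_d xp pn ptx.
have [np|{}pn] := leqP n p.
  by rewrite cnt_geq // addn0; apply: packs_mono ptx.
rewrite cnt_ltn //; have [bp|_] := boolP (bad p); last first.
  by rewrite add0n; apply: IHd => //; lia.
have [e [pe en nR p3 bad0]] := badP p pn bp.
have [t1 [t' [p1 pt' le_t]]] := packs_split wR ptx (leqW xp) pn.
have [t2 [t3 [p2 pt3 le_t']]] := packs_split wR pt' pe en.
have t20 : t2 = 0.
  case: t2 p2 {le_t'} => // t2 /= [z Rz /(packs_length wR) ze].
  by case: nR; apply: wR.2 Rz => //; lia.
have pe3 := IHd t3 e e _ (leqnn e) en pt3.
have {}pe3 : packs R' (t3 + cnt bad e n) e n by apply: pe3; lia.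
have := packs_cat wR' (packs_mono RR' p1) (packs_cat wR' p3 pe3).
apply: packs_weaken => //; rewrite (cnt_cat bad pe en) bad0; lia.
Qed.

(** * A roof over two adjacent ones *)

Definition rich (B : nat -> pred nat) (m i x y : nat) : Prop :=
  exists2 u, u < i & m <= cnt (B u) x y.

Lemma widening_rich (B : nat -> pred nat) (m i : nat) :
  0 < m -> widening (rich B m i).
Proof.
move=> m0; split=> [x y [u _]|x x' y y' x'x yy' [u ui mu]].
  by rewrite ltnNge; apply: contraTN => /cnt_geq->; rewrite -ltnNge.
by exists u => //; apply: leq_trans (cnt_widen _ x'x yy').
Qed.

(** The columns from [k.+1] to [e] stay within the chunk of 3m + 1 ones led by
[k] in row [i], as at most 3m ones of that row lie there. *)
Definition good (B : nat -> pred nat) (m n i k : nat) : bool :=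
  [exists u : 'I_i, exists e : 'I_n,
     (m <= cnt (B u) k.+1 e.+1) && (cnt (B i) k.+1 e.+1 <= 3 * m)].

(** Fails for a leader [k] only when its chunk is the last one and cut short. *)
Definition full (b : pred nat) (s n k : nat) : bool :=
  cnt b 0 k + s <= cnt b 0 n.

Definition bad (B : nat -> pred nat) (m n i k : nat) : bool :=
  [&& leader (B i) (3 * m).+1 k, full (B i) (3 * m).+1 n k & ~~ good B m n i k].

Lemma goodP (B : nat -> pred nat) (m n i k : nat) :
  0 < m ->
  reflect (exists u e, [/\ u < i, e <= n, m <= cnt (B u) k.+1 e
                         & cnt (B i) k.+1 e <= 3 * m])
          (good B m n i k).
Proof.
move=> m0; apply: (iffP existsP) => [[u /existsP[e /andP[mu ui]]]|].
  by exists u, e.+1; split.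
move=> [u [[|e] [ui en mu ui3]]].
  by move: mu; rewrite cnt_geq // leqNgt m0.
by exists (Ordinal ui); apply/existsP; exists (Ordinal en); apply/andP.
Qed.

(** The 3m ones of the chunk after its leader split into three groups of m, each
of which makes an interval rich for the rows below; goodness fails exactly
because none is rich for row [i] itself. *)
Lemma bad_chunk (B : nat -> pred nat) (m n i p : nat) :
  0 < m -> p < n -> bad B m n i p -> exists e,
    [/\ p < e, e <= n, ~ rich B m i p.+1 e, packs (rich B m i.+1) 3 p.+1 e
      & cnt (bad B m n i) p.+1 e = 0].
Proof.
move=> m0 pn /and3P[lead_p]; rewrite /full (cnt_cat _ (leq0n p) (ltnW pn)).
rewrite leq_add2l => s_le ngood.
have [e [pe en cnt_e]] := cnt_ivt (ltnW pn) s_le.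
have {}pe : p < e by rewrite ltnNge; apply: contraPN cnt_e => /cnt_geq->.
have Bp : B i p by case/andP: lead_p.
have cnt_e1 : cnt (B i) p.+1 e = 3 * m.
  by move: cnt_e; rewrite cnt_ltn // Bp => -[].
exists e; split=> //.
- move=> [u ui mu]; case/negP: ngood; apply/goodP => //.
  by exists u, e; rewrite cnt_e1.
- have [|z1 [pz1 z1e c1]] := @cnt_ivt (B i) m _ _ pe; first by rewrite cnt_e1; lia.
  have := cnt_cat (B i) pz1 z1e; rewrite cnt_e1 c1 => c1e.
  have [|z2 [z12 z2e c2]] := @cnt_ivt (B i) m _ _ z1e; first by lia.
  have := cnt_cat (B i) z12 z2e; rewrite c2 => c2e.
  by exists z1; [|exists z2; [|exists e => //=]]; exists i => //; lia.
- apply/eqP; rewrite eqn0Ngt; apply/negP => /cnt_gt0[q [pq qe]].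
  case/and3P=> lead_q _ _; have := leaders_gap lead_p lead_q pq.
  have Bq : B i q by case/andP: lead_q.
  have := cnt_cat (B i) (ltnW pq) (ltnW qe).
  by rewrite (cnt_ltn _ qe) Bq cnt_e; lia.
Qed.

(** Row after row, the bad positions found so far are outnumbered by disjoint rich
intervals, and there is room for at most [n] of these. *)
Lemma weight_bad (B : nat -> pred nat) (m n : nat) :
  0 < m -> weight n (bad B m n) <= n.
Proof.
move=> m0; suff /(_ n): forall i,
    packs (rich B m i) (\sum_(0 <= u < i) cnt (bad B m n u) 0 n) 0 n.
  by move/packs_length; rewrite add0n; apply; apply: widening_rich.
elim=> [|i IHi]; first by rewrite big_geq.
rewrite big_nat_recr //=; apply: packs_row IHi => //.
- exact: widening_rich.
- exact: widening_rich.
- by move=> x y [u ui mu]; exists u => //; apply: leqW.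
- by move=> p pn; apply: bad_chunk.
Qed.

(** Every leader is good, or bad, or leads the incomplete last chunk of its row,
and the last two kinds number at most [n] each. *)
Lemma weight_good (B : nat -> pred nat) (m n : nat) : 0 < m ->
  weight n B <= (3 * m).+1 *
    (weight n (fun i k => leader (B i) (3 * m).+1 k && good B m n i k) + 2 * n).
Proof.
move=> m0; set s := (3 * m).+1; set B' := fun i k => _.
have := weight_scale (fun i => leaders_many (B i) n (ltn0Sn (3 * m))).
move/leq_trans; apply; rewrite -/s leq_mul2l; apply/orP; right.
pose inc i k := leader (B i) s k && ~~ full (B i) s n k.
have inc_n : weight n inc <= n.
  apply: weight_rows => i _; apply: cnt_le1 => k k' kk' k'n.
  move=> /andP[lk /negP nfull] /andP[lk' _]; apply: nfull; rewrite /full.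
  rewrite (cnt_cat _ (leq0n k) (ltnW (ltn_trans kk' k'n))) leq_add2l.
  apply: leq_trans (leaders_gap lk lk' kk') _; apply: cnt_widen => //.
  exact: ltnW.
have := @weight_sub n (fun i => leader (B i) s)
  (fun i k => B' i k || bad B m n i k) inc.
have := @weight_sub n (fun i k => B' i k || bad B m n i k) B' (bad B m n).
have := weight_bad B n m0.
move=> bad_n sub1 sub2.
have {}sub1 := sub1 (fun i k _ _ => id).
have {}sub2 : weight n (fun i => leader (B i) s) <= 
    weight n (fun i k => B' i k || bad B m n i k) + weight n inc.
  apply: sub2 => i k _ _ lk; rewrite /B' /bad /inc -/s lk /=.
  by case: good; case: full.
lia.
Qed.

Lemma entry_roof (P : mat01) (c i k : nat) : entry (roof P c) i k ->
  (i = 0 /\ c < k <= c + 2) \/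
  (0 < i /\ (k <= c /\ entry P i.-1 k \/ c + 2 < k /\ entry P i.-1 (k - 2))).
Proof.
rewrite entry_col_mx; case: ltnP => i1.
  case/(@entry_row _ (fun k => (k == c.+1) || (k == c.+2))) => -> kc.
  by left; split=> //; case/orP: kc => /eqP->; lia.
rewrite /insert_cols entry_build01 subn1 => /and3P[_ _].
case: (leqP k c) => kc; first by right; split=> //; left.
by case: (leqP k (c + 2)) => // kc2; right; split=> //; right.
Qed.

(** In a copy of [P] among the good leaders, the images of the two adjacent ones
lead distinct chunks, so the m ones of a higher row that come with the first of
them lie strictly between these images. *)
Lemma forces_roof (P : mat01) (c j C n0 : nat) :
  forces P C n0 -> entry P 0 c -> entry P 0 c.+1 ->
  forces (insert_cols (roof P c) c.+1 j (pred1 0))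
         ((C + 2) * (3 * (2 + j)).+1) n0.
Proof.
move=> forP Pc PcS n B n0n wB; set m := 2 + j in wB *.
have m0 : 0 < m by [].
have [|F [G [Fpl Gpl FG]]] := forP n
    (fun i k => leader (B i) (3 * m).+1 k && good B m n i k) n0n.
  by have := weight_good B n m0; nia.
have [aP cP] := entry_bound PcS.
have Gcc : G c < G c.+1 by apply: Gpl.1.
have /andP[lc /(goodP _ _ _ _ m0)[u [e [uF en mu e3]]]] := FG _ _ Pc.
have /andP[lc' _] := FG _ _ PcS.
have BGc : B (F 0) (G c) by case/andP: lc.
have BGc' : B (F 0) (G c.+1) by case/andP: lc'.
have gap := leaders_gap lc lc' Gcc.
(* If the interval reached beyond the next leader, it would contain more than
   3m ones of the row. *)
have eG : e <= G c.+1.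
  rewrite leqNgt; apply/negP => Ge; move: gap e3.
  by rewrite cnt_ltn // BGc (cnt_cat _ Gcc (ltnW Ge)) (cnt_ltn _ Ge) BGc'; lia.
have [|T Tpl TB] := @cnt_select (B u) m (G c).+1 (G c.+1).
  exact: leq_trans mu (cnt_widen _ _ eG).
exists (fun i => if i is i'.+1 then F i' else u), (insert c m G T); split.
- by apply: placement_cons => //; apply: ltn_trans uF (Fpl.2 _ aP).
- have -> : ncols (insert_cols (roof P c) c.+1 j (pred1 0)) = ncols P + m.
    by rewrite /= /m addnA.
  apply: placement_insert => // [|l lm].
    exact: placement_widen (ltnW (Gpl.2 _ cP)) Tpl.
  by rewrite (TB l lm).1 Tpl.2.
move=> i k; rewrite entry_build01 /insert => /and3P[_ _].
have FGB i' k' : entry P i' k' -> B (F i') (G k').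
  by case/FG/andP=> /andP[].
have Tk : c < k -> k <= c + m -> B u (T (k - c.+1)).
  by move=> ck kcm; apply: (TB _ _).2; lia.
case: (leqP k c.+1) => kc.
  case/entry_roof=> [[-> ck]|[i0 [[kc' Pik]|[]]]]; last by lia.
    by rewrite (leqNgt k c) (_ : c < k) ?ifT; [apply: Tk|..]; lia.
  by rewrite kc'; case: i i0 Pik => // i _ /FGB.
have ck : c < k by lia.
rewrite (leqNgt k c) ck /=; case: (leqP k (c.+1 + j)) => kcj.
  by move=> /eqP->; rewrite ifT; [apply: Tk|]; lia.
case/entry_roof=> [[-> kcj']|[i0 [[]|[kc2 Pik]]]]; last 2 first.
- by lia.
- rewrite ifF; last by lia.
  have -> : k - m = k - j - 2 by lia.
  by case: i i0 Pik => // i _ /FGB.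
by rewrite ifT; [apply: Tk|]; lia.
Qed.

Lemma ramsey_linear_roof (P : mat01) (c C n0 : nat) :
  forces P C n0 -> entry P 0 c -> entry P 0 c.+1 ->
  ramsey_linear (fun j => insert_cols (roof P c) c.+1 j (pred1 0)).
Proof.
move=> forP Pc PcS; have [a0 b0] := entry_bound PcS.
apply: (@ramsey_linear_forces _ (3 * (C + 2) + n0)) => j _.
have jv : 3 + j <= nverts (GP (insert_cols (roof P c) c.+1 j (pred1 0))).
  by move=> /=; lia.
split; first exact: leq_trans jv.
by apply: forces_mono (forces_roof forP Pc PcS); nia.
Qed.

(** * Chains of copies *)

(** The index map of two glued patterns, the first one with [a] lines, whose line
[a.-1] is also line 0 of the second one. *)
Definition glue (a : nat) (F F' : nat -> nat) (i : nat) : nat :=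
  if i < a then F i else F' (i - a.-1).

Lemma glue_right (a i : nat) (F F' : nat -> nat) :
  0 < a -> F a.-1 = F' 0 -> a.-1 <= i -> glue a F F' i = F' (i - a.-1).
Proof.
move=> a0 FF' ai; rewrite /glue; case: ltnP => // ia.
have -> : i = a.-1 by lia.
by rewrite subnn.
Qed.

Lemma placement_glue (a b n : nat) (F F' : nat -> nat) :
  0 < a -> placement a n F -> placement b n F' -> F a.-1 = F' 0 ->
  placement (a.-1 + b) n (glue a F F').
Proof.
move=> a0 Fpl Fpl' FF'; split=> [i i' ii' i'ab|i iab]; last first.
  by rewrite /glue; case: (ltnP i a) => ia; [apply: Fpl.2|apply: Fpl'.2; lia].
have [ai|ia] := leqP a.-1 i.
  have ai' : a.-1 <= i' by lia.
  by rewrite !glue_right //; apply: Fpl'.1; lia.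
rewrite {1}/glue ifT; last by lia.
have [i'a|ai'] := ltnP i' a; first by rewrite /glue i'a; apply: Fpl.1.
apply: leq_trans (Fpl.1 i a.-1 ia _) _; first by lia.
rewrite FF' glue_right //; last by lia.
by apply: placement_leq Fpl' _ _; lia.
Qed.

Lemma entry_corner_chain_last (P : mat01) (j : nat) :
  entry P (nrows P).-1 (ncols P).-1 ->
  entry (corner_chain P j) (nrows (corner_chain P j)).-1
    (ncols (corner_chain P j)).-1.
Proof.
move=> Pend; have [aP bP] := entry_bound Pend; rewrite /corner_chain.
case: j => [|j] //=; set Q := iter j _ P.
rewrite entry_build01; apply/and3P; split; try lia.
apply/orP; right; apply/and3P; split; try lia.
have shift m p : (m + p).-1 - m = p.-1 by lia.
by rewrite !shift.
Qed.

(** The ones that are not the top left corner of a copy of [P] avoid [P], so there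
are at most C n of them.  A chain among the other ones can be continued by the
copy of [P] that starts at its last corner. *)
Lemma forces_corner_chain (P : mat01) (j C n0 : nat) :
  forces P C n0 -> entry P 0 0 -> entry P (nrows P).-1 (ncols P).-1 ->
  forces (corner_chain P j) (C * j.+1) n0.
Proof.
move=> forP P00 Pend; elim: j => [|j IHj]; first by rewrite muln1.
move=> n B n0n wB.
pose start x y := exists F G, [/\ occurs n B P F G, F 0 = x & G 0 = y].
pose B' x y := B x y && `[< start x y >].
have [|F [G [Fpl Gpl FG]]] := IHj n B' n0n.
  pose rest x y := B x y && ~~ `[< start x y >].
  have sub : weight n B <= weight n B' + weight n rest.
    by apply: weight_sub => x y _ _ Bxy; rewrite /B' /rest Bxy orbN.
  have few : weight n rest <= C * n.
    rewrite leqNgt; apply/negP => /(forP n _ n0n)[F [G [Fpl Gpl FG]]].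
    have /andP[_ /asboolP[]] := FG _ _ P00; exists F, G; split=> //; split=> // i k.
    by case/FG/andP.
  by move: wB; rewrite mulnS mulnDl; lia.
have Qend := entry_corner_chain_last j Pend.
have [aQ bQ] := entry_bound Qend.
have /andP[_ /asboolP[F' [G' [[Fpl' Gpl' FG'] FF' GG']]]] := FG _ _ Qend.
set Q := corner_chain P j in Fpl Gpl FG Qend aQ bQ FF' GG' *.
have {}aQ : 0 < nrows Q by lia.
have {}bQ : 0 < ncols Q by lia.
exists (glue (nrows Q) F F'), (glue (ncols Q) G G'); split=> /=.
- exact: placement_glue.
- exact: placement_glue.
move=> i k; rewrite entry_build01 => /and3P[_ _ /orP[Qik|/and3P[i0 k0 Pik]]].
  have [iQ kQ] := entry_bound Qik; rewrite /glue iQ kQ.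
  by case/andP: (FG _ _ Qik).
by rewrite !glue_right //; apply: FG'.
Qed.

Lemma corner_chain_small (P : mat01) (j : nat) :
  nrows P <= 1 -> ncols P <= 1 ->
  nrows (corner_chain P j) <= 1 /\ ncols (corner_chain P j) <= 1.
Proof. by move=> a1 b1; elim: j => //= j; rewrite -/(corner_chain P j); lia. Qed.

(** Each glueing adds a row or a column, since [P] is larger than 1 by 1. *)
Lemma corner_chain_nverts (P : mat01) (j : nat) :
  0 < nrows P -> 0 < ncols P -> 1 < nrows P \/ 1 < ncols P ->
  j < nverts (GP (corner_chain P j)).
Proof.
move=> a0 b0 ab; suff: [/\ 0 < nrows (corner_chain P j),
  0 < ncols (corner_chain P j) & j < nverts (GP (corner_chain P j))] by case.
elim: j => [|j [aQ bQ jQ]]; first by split=> //=; lia.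
set Q := corner_chain P j in aQ bQ jQ.
by change (corner_chain P j.+1) with (corner_glue Q P); split; move: jQ => /=; lia.
Qed.

Lemma ramsey_linear_corner_chain (P : mat01) (C n0 : nat) :
  forces P C n0 -> entry P 0 0 -> entry P (nrows P).-1 (ncols P).-1 ->
  ramsey_linear (corner_chain P).
Proof.
move=> forP P00 Pend; have [a0 b0] := entry_bound P00.
have [/andP[a1 b1]|large] := boolP ((nrows P <= 1) && (ncols P <= 1)).
  (* The size does not grow with j, and neither may the bound. *)
  apply: (@ramsey_linear_forces _ 0) => j _; split.
    by have [] := entry_bound (entry_corner_chain_last j Pend); move=> /=; lia.
  by have [] := corner_chain_small j a1 b1; apply: forces_small.
apply: (@ramsey_linear_forces _ (C + n0)) => j _.
have jv : j < nverts (GP (corner_chain P j)).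
  by apply: corner_chain_nverts => //; apply/orP; rewrite !ltnNge -negb_and.
split; first exact: leq_ltn_trans jv.
by apply: forces_mono (forces_corner_chain forP P00 Pend); nia.
Qed.

(** * Empty rows and columns inserted everywhere *)

Lemma sum_residues (f : nat -> nat) (n d : nat) :
  \sum_(0 <= i < n * d) f i = \sum_(0 <= x < d) \sum_(0 <= i < n) f (i * d + x).
Proof.
rewrite big_nat_mul exchange_big_nat /=; apply: eq_bigr => i _.
rewrite -{1}[i * d]add0n big_addn mulSn addnK.
by apply: eq_bigr => x _; rewrite addnC.
Qed.

Lemma sum_pigeonhole (f : nat -> nat) (c d : nat) :
  d * c < \sum_(0 <= x < d) f x -> exists2 x, x < d & c < f x.
Proof.
elim: d => [|d IHd]; first by rewrite big_geq.
rewrite big_nat_recr //= => lt_sum; have [fd|cf] := leqP (f d) c.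
  by have [|x xd cx] := IHd; [lia | exists x; first apply: leqW].
by exists d.
Qed.

Lemma weight_residues (n d c : nat) (B : nat -> pred nat) :
  d * d * c < weight (n * d) B ->
  exists x y, [/\ x < d, y < d
    & c < weight n (fun i k => B (i * d + x) (k * d + y))].
Proof.
rewrite /weight sum_residues -mulnA => /sum_pigeonhole[x xd].
under eq_bigr => i _ do rewrite /cnt sum_residues.
by rewrite exchange_big_nat => /sum_pigeonhole[y yd cxy]; exists x, y.
Qed.

(** Position q (j + 1) + r goes to the line of the residue class of [x] chosen for
q, moved on by r; successive chosen lines are at least j + 1 apart. *)
Lemma placement_spread (a n j x : nat) (F : nat -> nat) :
  placement a n F -> x < j.+1 ->
  placement (a + j * a.-1) (n * j.+1)
    (fun i => F (i %/ j.+1) * j.+1 + x + i %% j.+1).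
Proof.
move=> [F_i F_n] xj; set d := j.+1 in xj *.
have qa i : i < a + j * a.-1 -> i %/ d < a.
  by move=> ia; rewrite ltn_divLR // /d; nia.
have step i q : i %/ d < q -> q < a -> F (i %/ d) * d + i %% d < F q * d.
  by move=> iq /(F_i _ _ iq) Fq; have := ltn_pmod i (ltn0Sn j); rewrite -/d; nia.
split=> [i i' ii' i'a|i ia]; last first.
  (* Only a multiple of d can have the last line of the pattern as quotient. *)
  have [i0|i0] := posnP (i %% d).
    by have := F_n _ (qa _ ia); rewrite i0; nia.
  have Sq : (i %/ d).+1 < a.
    have := divn_eq i d; move: (i %/ d) (i %% d) i0 => q r r0 iE.
    by move: ia; rewrite iE /d; nia.
  by have := step i _ (ltnSn _) Sq; have := F_n _ Sq; nia.
have := leq_div2r d (ltnW ii'); rewrite leq_eqVlt => /orP[/eqP qq'|qq'].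
  by rewrite qq' ltn_add2l; have := divn_eq i d; have := divn_eq i' d; rewrite qq'; lia.
by have := step _ _ qq' (qa _ i'a); lia.
Qed.

(** The residue classes modulo [j.+1] partition the entries into squares of size
[n], one of which is at least as dense as the whole. *)
Lemma dense_spread (P : mat01) (j C n0 n : nat) :
  forces P C n0 -> n0 <= n -> 2 * C < n -> dense (n * j.+1) (spread P j).
Proof.
move=> forP n0n Cn B wB.
have [|x [y [xd yd wxy]]] := @weight_residues n j.+1 (C * n) B; first by nia.
have [F [G [Fpl Gpl FG]]] := forP n _ n0n wxy.
exists (fun i => F (i %/ j.+1) * j.+1 + x + i %% j.+1).
exists (fun k => G (k %/ j.+1) * j.+1 + y + k %% j.+1); split=> /=.
- exact: placement_spread.
- exact: placement_spread.
move=> i k; rewrite entry_build01 => /and5P[_ _ /eqP-> /eqP-> /FG].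
by rewrite !addn0.
Qed.

Lemma ramsey_linear_spread (P : mat01) : ex_linear P -> ramsey_linear (spread P).
Proof.
move=> /ex_linear_forces[C [n0 forP]]; apply: ramsey_linear_dense.
pose n := (2 * C + n0).+1; exists n => j _.
have [/andP[a1 b1]|large] := boolP ((nrows P <= 1) && (ncols P <= 1)); last first.
  exists (n * j.+1); last by apply: dense_spread forP _ _; rewrite /n; lia.
  rewrite leq_mul2l /=; move: large; rewrite negb_and -!ltnNge.
  by move: (nrows P) (ncols P) => a b /orP[]; nia.
(* A pattern of size at most 1 by 1 does not grow with j, so n may not either;
   it has no vertex at all when it is empty, and then n must be 0. *)
have small : nrows (spread P j) <= 1 /\ ncols (spread P j) <= 1 by move=> /=; nia.
exists (nverts (GP (spread P j))); first by rewrite /n mulSn leq_addr.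
have [v0|v0] := posnP (nverts (GP (spread P j))); last first.
  exact: forces_dense (forces_small small.1 small.2) _ _.
rewrite v0 => B _; exists id, id; move: v0 => /eqP; rewrite addn_eq0.
case/andP=> /eqP a0 /eqP b0; rewrite /occurs a0 b0; split=> //.
by move=> i k /entry_bound[]; rewrite a0.
Qed.

Theorem theorem18 (P : mat01) (hP : ex_linear P) :
  [/\ (* 1 *)
      border_one P ->
      forall Q : nat -> mat01,
        (forall j : nat, 0 < j -> border_steps P j (Q j)) ->
        ramsey_linear Q,
      (* 2 *)
      forall r c : nat, entry P r c -> entry P r c.+1 ->
        ramsey_linear (fun j => insert_cols P c j (pred1 r)),
      (* 3 *)
      forall c : nat, entry P 0 c -> entry P 0 c.+1 ->
        ramsey_linear (fun j => insert_cols (roof P c) c.+1 j (pred1 0)),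
      (* 4 *)
      entry P 0 0 -> entry P (nrows P).-1 (ncols P).-1 ->
        ramsey_linear (corner_chain P)
    & (* 5 *)
      ramsey_linear (spread P)].
Proof.
have [C [n0 forP]] := ex_linear_forces hP; split.
- by move=> _ Q; apply: ramsey_linear_border_steps forP.
- by move=> r c; apply: ramsey_linear_insert_cols forP.
- by move=> c; apply: ramsey_linear_roof forP.
- exact: ramsey_linear_corner_chain forP.
- exact: ramsey_linear_spread.
Qed.
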